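(* Let $k\ge 2$ and $n\ge 0$ be integers with $k \nmid n$. Then $a_k(n)$ satisfies the generalized pentagonal number recurrence relation $$a_k(n)=\sum_{j\ge 1}(-1)^{j-1}\left[a_k\!\left(n-\tfrac{j(3j-1)}{2}\right)+a_k\!\left(n-\tfrac{j(3j+1)}{2}\right)\right],$$ that is, $a_k(n)=a_k(n-1)+a_k(n-2)-a_k(n-5)-a_k(n-7)+a_k(n-12)+a_k(n-15)-a_k(n-22)-a_k(n-26)+\cdots$.
   Context: For integers $n\ge 0$ and $k\ge 2$, $a_k(n)$ is the total number of parts divisible by $k$, counted with multiplicity, in all partitions of $n$ in which every part has multiplicity strictly less than $k$. (Writing a partition as $(\lambda_1^{m_1},\ldots,\lambda_\ell^{m_\ell})$ with distinct positive integer parts $\lambda_i$ of multiplicity $m_i\ge1$ and $\sum_i m_i\lambda_i=n$, $a_k(n)$ is the sum over all partitions of $n$ with all $m_i<k$ of $\sum_{i:\,k\mid\lambda_i} m_i$.) By convention $a_k(r)=0$ for $r<0$, so the sum is finite. *)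

(* Defs.v *)
From mathcomp Require Import all_boot all_order all_algebra.
From mathcomp Require Import zify.
From mathcomp Require Import boolp classical_sets functions cardinality fsbigop.

Set Implicit Arguments.
Unset Strict Implicit.
Unset Printing Implicit Defensive.

Import Order.TTheory GRing.Theory Num.Theory.

Local Open Scope classical_set_scope.
Local Open Scope ring_scope.

(* A partition of n is given by its multiplicities: m i is the number of
   occurrences of the part i.+1. No part and no multiplicity exceeds n, so
   these bounds lose nothing and make the set of partitions finite. *)
Definition multiplicities (n : nat) := {ffun 'I_n -> 'I_n.+1}.

Definition is_partition (n : nat) (m : multiplicities n) : bool :=
  (\sum_(i < n) m i * i.+1 == n)%N.

Definition mult_lt (k n : nat) (m : multiplicities n) : bool :=
  [forall i : 'I_n, (m i < k)%N].

Definition parts_div (k n : nat) (m : multiplicities n) : nat :=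
  (\sum_(i < n | k %| i.+1) m i)%N.

Definition a_nat (k n : nat) : nat :=
  (\sum_(m : multiplicities n | is_partition m && mult_lt k m)
      parts_div k m)%N.

Definition a (k : nat) (r : int) : int :=
  match r with
  | Posz n => (a_nat k n)%:Z
  | Negz _ => 0
  end.

(* \sum_(j \in A) is the sum over the support when that is finite and 0
   otherwise; this lemma rules out the second case for the pentagonal series.
   For 1 <= j its truncated subtractions and divisions by 2 are exact. *)
Lemma pentagonal_finite_support (k n : nat) :
  finite_set ([set j : nat | (1 <= j)%N] `&`
    (fun j : nat => (-1) ^+ (j - 1) *
       (a k (n%:Z - (j * (3 * j - 1) %/ 2)%N%:Z)
        + a k (n%:Z - (j * (3 * j + 1) %/ 2)%N%:Z))) @^-1` [set~ 0]).
Proof.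
have a_lt0 r : r < 0 -> a k r = 0 by case: r.
apply: (sub_finite_set (B := `I_n.+1)) (finite_II _) => j [/= j1 tj].
rewrite ltnS leqNgt; apply/negP => ltnj; apply: tj.
have le1 : (j <= j * (3 * j - 1) %/ 2)%N.
  by rewrite leq_divRL// leq_mul2l; apply/orP; right; lia.
have le2 : (j <= j * (3 * j + 1) %/ 2)%N.
  by rewrite leq_divRL// leq_mul2l; apply/orP; right; lia.
by rewrite /preimage/= !a_lt0 ?addr0 ?mulr0//;
   rewrite subr_lt0 ltz_nat (leq_trans ltnj).
Qed.

(* Main.v *)
Require Import Defs.
From mathcomp Require Import all_boot all_order all_algebra.
From mathcomp Require Import boolp classical_sets functions cardinality fsbigop.
From mathcomp Require Import zify ring.

Set Implicit Arguments.
Unset Strict Implicit.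
Unset Printing Implicit Defensive.

Import Order.TTheory GRing.Theory Num.Theory.

Local Open Scope classical_set_scope.
Local Open Scope ring_scope.

(** The partitions with all multiplicities below k are generated by the product
over j of the factors 1 + X^j + ... + X^((k-1)j). Counting their parts divisible
by k adds up variants of this product: for each j divisible by k, the j-th
factor is replaced by the sum of the m X^(mj), a polynomial in X^k. Multiplying by the Euler product of the 1 - X^j turns every other factor
into 1 - X^(kj), again a polynomial in X^k, and the factor 1 - X^j that meets
the replaced one also is, since k divides j. So the Euler product times the
generating function of a_k is supported on the exponents divisible by k
([euler_gen_supported]): for n not divisible by k its coefficient at n is 0.
Expanding the Euler product by the pentagonal number theorem turns this
vanishing into the recurrence.

Both facts are proved with polynomials in place of power series. Keeping only
the parts up to N does not disturb the argument above, and changes no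
coefficient of the generating function up to X^N ([coef_gen_poly]). The
pentagonal number theorem is needed up to X^n only, and there Shanks's finite
identity gives it: an explicit sum S_n ([shanks_sum]) equals the pentagonal
sum cut at n ([shanks_identity]), since S_(n+1) - S_n telescopes, and it agrees
with the Euler product up to X^n because all its terms but the first are
multiples of X^(n+1) ([euler_prod_shanks]). *)

(** * A truncated pentagonal number theorem *)

Definition euler_prod (n : nat) : {poly int} := \prod_(i < n) (1 - 'X^(i.+1)).

(** The quotient of the Euler products of lengths n and s, written without a
division. *)
Definition euler_tail (n s : nat) : {poly int} :=
  \prod_(s <= i < n) (1 - 'X^(i.+1)).

Definition pent (j : nat) : nat := (j * (3 * j - 1) %/ 2)%N.
(** The pentagonal number of index - j. *)
Definition pent_neg (j : nat) : nat := (j * (3 * j + 1) %/ 2)%N.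

Definition shanks_sum (n : nat) : {poly int} :=
  \sum_(0 <= s < n.+1)
    (-1) ^+ s * euler_tail n s * 'X^(s * n + 'C(s.+1, 2)).

(** This form removes the division, and is the exponent at which the
telescoping sum of [shanks_sumS] ends. *)
Lemma pentE j : pent j.+1 = (j.+1 * j.+1 + 'C(j.+1, 2))%N.
Proof.
rewrite /pent bin2 -divn2 /=.
have -> : (j.+1 * (3 * j.+1 - 1) = j.+1 * j.+1 * 2 + j.+1 * j)%N by lia.
by rewrite divnMDl.
Qed.

(** Likewise, this is the exponent of the last term of [shanks_sum]. *)
Lemma pent_negE j : pent_neg j = (j * j + 'C(j.+1, 2))%N.
Proof.
rewrite /pent_neg bin2 -divn2 /=.
have -> : (j * (3 * j + 1) = j * j * 2 + j.+1 * j)%N by lia.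
by rewrite divnMDl.
Qed.

(** The last term of the longer sum is the second monomial. In each other index
s the two sums differ by a difference U (s-1) - U s: the longer tail splits off
the factor 1 - X^(n+1), and one of the resulting pieces carries a factor
1 - X^s that extends the tail from s down to s-1. What remains, - U n, is the
first monomial. *)
Lemma shanks_sumS n :
  shanks_sum n.+1 = shanks_sum n
    + (-1) ^+ n.+1 * ('X^(pent n.+1) + 'X^(pent_neg n.+1)).
Proof.
pose U s : {poly int} :=
  (-1) ^+ s * euler_tail n s * 'X^(s.+1 * n.+1 + 'C(s.+1, 2)).
have step s : (s <= n)%N ->
    (-1) ^+ s * euler_tail n.+1 s * 'X^(s * n.+1 + 'C(s.+1, 2))
    - (-1) ^+ s * euler_tail n s * 'X^(s * n + 'C(s.+1, 2))
    = (if s is s'.+1 then U s' else 0) - U s.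
  move=> les; rewrite /U {1}/euler_tail big_nat_recr//= -/(euler_tail n s).
  case: s les => [|s] les.
    by rewrite !mul0n mul1n bin_small// !addn0 !expr0; ring.
  have -> : euler_tail n s = (1 - 'X^(s.+1)) * euler_tail n s.+1.
    by rewrite /euler_tail big_ltn.
  (* All exponents are written from the same summands, for [ring] to factor. *)
  have -> : (s.+1 * n.+1 + 'C(s.+2, 2) = s.+1 * n + 'C(s.+1, 2) + s.+1 + s.+1)%N.
    by rewrite binS bin1; lia.
  have -> : (s.+2 * n.+1 + 'C(s.+2, 2)
             = s.+1 * n + 'C(s.+1, 2) + s.+1 + s.+1 + n.+1)%N.
    by rewrite binS bin1; lia.
  have -> : (s.+1 * n.+1 + 'C(s.+1, 2) = s.+1 * n + 'C(s.+1, 2) + s.+1)%N.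
    by lia.
  have -> : (s.+1 * n + 'C(s.+2, 2) = s.+1 * n + 'C(s.+1, 2) + s.+1)%N.
    by rewrite binS bin1; lia.
  rewrite !exprD (exprS (-1) s); ring.
have last_term : shanks_sum n.+1 = \sum_(0 <= s < n.+1)
      (-1) ^+ s * euler_tail n.+1 s * 'X^(s * n.+1 + 'C(s.+1, 2))
    + (-1) ^+ n.+1 * 'X^(pent_neg n.+1).
  rewrite /shanks_sum big_nat_recr//= pent_negE.
  by rewrite (_ : euler_tail n.+1 n.+1 = 1) ?mulr1// /euler_tail big_geq.
have tele m : \sum_(0 <= s < m.+1) ((if s is s'.+1 then U s' else 0) - U s)
    = - U m.
  elim: m => [|m IH]; first by rewrite big_nat1 sub0r.
  by rewrite big_nat_recr//= IH; ring.
have Un : U n = - ((-1) ^+ n.+1 * 'X^(pent n.+1)).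
  by rewrite /U /euler_tail big_geq// pentE exprS; ring.
apply/(@addIr _ (- shanks_sum n)); rewrite last_term addrAC -sumrB.
under eq_big_nat => s /andP[_ ls] do rewrite step//.
rewrite tele Un; ring.
Qed.

Lemma shanks_identity n :
  shanks_sum n =
  1 + \sum_(1 <= j < n.+1) (-1) ^+ j * ('X^(pent j) + 'X^(pent_neg j)).
Proof.
elim: n => [|n IH].
  rewrite /shanks_sum big_nat1 big_geq// /euler_tail big_geq// bin_small//.
  by rewrite !mul1r addr0.
by rewrite shanks_sumS IH [in RHS]big_nat_recr//= addrA.
Qed.

(** The term of index 0 in [shanks_sum] is the Euler product, and the term of
index s > 0 is a multiple of X^(n+1), as s n + s(s+1)/2 >= n + 1. *)
Lemma euler_prod_shanks n :
  exists R : {poly int}, euler_prod n = shanks_sum n + R * 'X^(n.+1).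
Proof.
exists (- \sum_(1 <= s < n.+1)
   (-1) ^+ s * euler_tail n s * 'X^(s.-1 * n + 'C(s, 2) + s.-1)).
rewrite /shanks_sum big_ltn// mulNr mulr_suml.
under [X in _ - X]eq_big_nat => s /andP[s0 ls].
  rewrite -!mulrA -exprD mulrA.
  have -> : (s.-1 * n + 'C(s, 2) + s.-1 + n.+1 = s * n + 'C(s.+1, 2))%N.
    by rewrite binS bin1; case: s s0 {ls} => // s _ /=; lia.
  over.
by rewrite addrK /euler_tail /euler_prod big_mkord bin_small// mul1r mulr1.
Qed.

(** * Polynomials in a power of the variable *)

Definition supported_on_multiples (k : nat) (p : {poly int}) : Prop :=
  forall i, ~~ (k %| i)%N -> p`_i = 0.

Lemma supported_sum k (I : finType) (P : pred I) (F : I -> {poly int}) :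
  (forall i, P i -> supported_on_multiples k (F i)) ->
  supported_on_multiples k (\sum_(i | P i) F i).
Proof. by move=> HF i ki; rewrite coef_sum big1// => j /HF; apply. Qed.

Lemma supported_mul k p q :
  supported_on_multiples k p -> supported_on_multiples k q ->
  supported_on_multiples k (p * q).
Proof.
move=> Hp Hq i ki; rewrite coefM big1// => j _.
case: (boolP (k %| j)%N) => [kj|/Hp->]; last by rewrite mul0r.
rewrite Hq ?mulr0//; apply: contra ki => kij.
by rewrite -(subnKC (ltn_ord j : (j <= i)%N)) dvdn_add.
Qed.

Lemma supported_Xn k d : (k %| d)%N -> supported_on_multiples k 'X^d.
Proof.
by move=> kd i ki; rewrite coefXn; case: eqP => // ei; rewrite ei kd in ki.
Qed.

Lemma supported_1subXn k d :
  (k %| d)%N -> supported_on_multiples k (1 - 'X^d).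
Proof.
move=> kd i ki; rewrite coefB (supported_Xn kd ki) subr0.
by rewrite -(expr0 'X) (supported_Xn (dvdn0 k) ki).
Qed.

Lemma supported_prod k (I : finType) (F : I -> {poly int}) :
  (forall i, supported_on_multiples k (F i)) ->
  supported_on_multiples k (\prod_i F i).
Proof.
move=> HF; apply: big_ind => //; last exact: supported_mul.
by rewrite -(expr0 'X); apply/supported_Xn/dvdn0.
Qed.

(** * The generating polynomial of marked partitions *)

Section Weights.
Variables (N M : nat).
Implicit Type f : {ffun 'I_N -> 'I_M}.

Definition weight f : nat := (\sum_(i < N) f i * i.+1)%N.
Definition divparts k f : nat := (\sum_(i < N | k %| i.+1) f i)%N.
End Weights.

Definition gen_poly (k N : nat) : {poly int} :=
  \sum_(f : {ffun 'I_N -> 'I_k}) (divparts k f)%:R * 'X^(weight f).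

(** Counting the marked parts one index i at a time makes the weight of f a
product over the indices, so the sum over f factors. *)
Lemma gen_polyE k N : gen_poly k N =
  \sum_(i < N | (k %| i.+1)%N) \prod_(j < N)
    \sum_(m < k) (if j == i then m%:R else 1) * 'X^(m * j.+1).
Proof.
under [RHS]eq_bigr => i _ do rewrite bigA_distr_bigA /=.
rewrite exchange_big /=; apply: eq_bigr => f _.
rewrite /divparts natr_sum mulr_suml; apply: eq_bigr => i _.
rewrite big_split /= -big_mkcond /= big_pred1_eq.
by rewrite /weight expr_sum.
Qed.

(** The two products are multiplied index by index: an unmarked index gives
the telescoped 1 - X^(k(j+1)), the marked one a product of two polynomials in
X^(j+1) with k dividing j+1. *)
Lemma euler_gen_supported k N :
  supported_on_multiples k (euler_prod N * gen_poly k N).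
Proof.
rewrite gen_polyE mulr_sumr; apply: supported_sum => i ki.
rewrite /euler_prod -big_split /=; apply: supported_prod => j.
case: eqP => [->|_].
  apply: supported_mul; first exact: supported_1subXn.
  apply: supported_sum => m _ r kr.
  by rewrite mulr_natl coefMn (supported_Xn _ kr) ?mul0rn// dvdn_mull.
rewrite (_ : _ * _ = 1 - 'X^(k * j.+1)); first exact/supported_1subXn/dvdn_mulr.
under eq_bigr => m _ do rewrite mul1r mulnC exprM.
by rewrite -opprB mulNr -subrX1 opprB -exprM mulnC.
Qed.

(** * Independence of the bounds on parts and multiplicities *)

(** Extension by zero to all indices, which lets families with different bounds
be compared. *)
Definition mult_at N M (f : {ffun 'I_N -> 'I_M}) (j : nat) : nat :=
  if insub j is Some i then f i : nat else 0%N.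

Lemma mult_at_ord N M (f : {ffun 'I_N -> 'I_M}) (i : 'I_N) :
  mult_at f i = f i.
Proof. by rewrite /mult_at valK. Qed.

Lemma mult_at_out N M (f : {ffun 'I_N -> 'I_M}) j :
  (N <= j)%N -> mult_at f j = 0%N.
Proof. by move=> le; rewrite /mult_at insubF// ltnNge le. Qed.

(** Faithful only when [fits] below holds: it drops the indices from N' on and
sends multiplicities above M' to 0, the default value of [inord]. *)
Definition recode N M N' M' (f : {ffun 'I_N -> 'I_M}) : {ffun 'I_N' -> 'I_M'.+1} :=
  [ffun i : 'I_N' => inord (mult_at f i)].

Definition fits N' M' (g : nat -> nat) : Prop :=
  forall j, (g j < M'.+1)%N /\ ((N' <= j)%N -> g j = 0%N).

Lemma mult_at_recode N M N' M' (f : {ffun 'I_N -> 'I_M}) :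
  fits N' M' (mult_at f) -> mult_at (recode N' M' f) =1 mult_at f.
Proof.
move=> Hf j; have [lt0 out] := Hf j.
case: (ltnP j N') => [lj|le]; last by rewrite mult_at_out// out.
by rewrite (mult_at_ord _ (Ordinal lj)) ffunE inordK.
Qed.

Lemma mult_at_inj N M (f g : {ffun 'I_N -> 'I_M}) :
  mult_at f =1 mult_at g -> f = g.
Proof.
by move=> e; apply/ffunP => i; apply/val_inj; rewrite /= -!mult_at_ord.
Qed.

Lemma recodeK N M N' M' (f : {ffun 'I_N -> 'I_M.+1}) :
  fits N' M' (mult_at f) -> recode N M (recode N' M' f) = f.
Proof.
move=> Hf; apply: mult_at_inj => j.
rewrite mult_at_recode ?mult_at_recode// => i.
rewrite mult_at_recode//; split; last exact: mult_at_out.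
by rewrite /mult_at; case: insub.
Qed.

Lemma fits_mult_at N M (f : {ffun 'I_N -> 'I_M.+1}) : fits N M (mult_at f).
Proof.
move=> i; split; last exact: mult_at_out.
by rewrite /mult_at; case: insub.
Qed.

(** Both sums extend to the longer of the two index ranges, since the added
indices have multiplicity 0. *)
Lemma eq_mult_sum N M N' M' (f : {ffun 'I_N -> 'I_M})
    (g : {ffun 'I_N' -> 'I_M'}) (P : pred nat) (F : nat -> nat -> nat) :
  (forall i, F 0%N i = 0%N) -> mult_at f =1 mult_at g ->
  (\sum_(i < N | P i) F (f i) i = \sum_(i < N' | P i) F (g i) i)%N.
Proof.
move=> F0 e.
have widen N0 M0 (h : {ffun 'I_N0 -> 'I_M0}) : (N0 <= maxn N N')%N ->
    (\sum_(i < N0 | P i) F (h i) i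
     = \sum_(i < maxn N N' | P i) F (mult_at h i) i)%N.
  move=> le; under eq_bigr => i _ do rewrite -mult_at_ord.
  rewrite (big_ord_widen_cond _ P (fun i => F (mult_at h i) i) le).
  rewrite big_mkcondr /=; apply: eq_bigr => i _; case: ltnP => // out.
  by rewrite mult_at_out.
rewrite !widen ?leq_maxl ?leq_maxr//.
by apply: eq_bigr => i _; rewrite e.
Qed.

(** A single part i+1 with multiplicity m already contributes m(i+1) to the
weight. *)
Lemma fits_weight N M (f : {ffun 'I_N -> 'I_M}) r :
  weight f = r -> fits r r (mult_at f).
Proof.
move=> wf j.
have [lj|le] := ltnP j N; last by rewrite mult_at_out.
have : (mult_at f j * j.+1 <= r)%N.
  rewrite (mult_at_ord f (Ordinal lj)) -wf /weight.
  by rewrite (bigD1 (Ordinal lj)) //= leq_addr.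
move=> H; split; first by lia.
by move=> rj; apply/eqP; rewrite -leqn0; nia.
Qed.

Lemma fits_mult_lt k N r (m : multiplicities r) :
  (r <= N)%N -> mult_lt k.+1 m -> fits N k (mult_at m).
Proof.
move=> rN /forallP mk j; split.
  by rewrite /mult_at; case: insubP => // i _ _; apply: mk.
by move=> Nj; rewrite mult_at_out// (leq_trans rN).
Qed.

(** Recoding is a bijection between the two families of partitions of r: on
one side the weight r bounds both the parts and their multiplicities by r, on
the other the parts are at most r <= N and the multiplicities below k. *)
Lemma a_natE k N r : (0 < k)%N -> (r <= N)%N ->
  a_nat k r =
  (\sum_(f : {ffun 'I_N -> 'I_k} | weight f == r) divparts k f)%N.
Proof.
case: k => // k _ rN; rewrite /a_nat.
rewrite (reindex_onto (@recode N k.+1 r r) (@recode r r.+1 N k)) /=; last first.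
  by move=> m /andP[_ mk]; apply/recodeK/fits_mult_lt.
have cond f : weight f = r ->
    mult_at (recode r r f) =1 mult_at f.
  by move=> /fits_weight; apply: mult_at_recode.
apply: eq_big => [f|f].
  (* If f is recovered from its recoding, it has parts and multiplicities
     within the bounds, so the recoding preserves its weight. *)
  apply/idP/idP => [/andP[/andP[/eqP wt lt] /eqP fK]|/eqP wf].
    rewrite -wt /weight; apply/eqP.
    apply: (eq_mult_sum xpredT (F := fun m i => m * i.+1)%N) => // j.
    by rewrite -{1}fK mult_at_recode//; apply: fits_mult_lt.
  rewrite recodeK ?eqxx ?andbT; last exact: fits_weight.
  apply/andP; split.
    apply/eqP; rewrite -[RHS]wf /weight.
    apply: (eq_mult_sum xpredT (F := fun m i => m * i.+1)%N) => // j.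
    by rewrite cond.
  apply/forallP => i; rewrite -mult_at_ord cond//.
  by have [] := fits_mult_at f i.
move=> /andP[/andP[/eqP wt lt] /eqP fK].
apply: (eq_mult_sum (fun i => k.+1 %| i.+1)%N (F := fun m _ => m)%N) => // j.
by rewrite -[in RHS]fK [RHS]mult_at_recode//; apply: fits_mult_lt.
Qed.

Lemma coef_gen_poly k N r : (0 < k)%N -> (r <= N)%N ->
  (gen_poly k N)`_r = a k r%:Z.
Proof.
move=> k0 rN; rewrite /= (a_natE k0 rN) -natz natr_sum /gen_poly coef_sum.
rewrite [RHS]big_mkcond /=; apply: eq_bigr => f _.
rewrite mulr_natl coefMn coefXn eq_sym.
by case: eqP => _ //; rewrite mul0rn.
Qed.

Lemma a_lt0 k r : r < 0 -> a k r = 0.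
Proof. by case: r. Qed.

Lemma coef_gen_polyXn k n e : (0 < k)%N ->
  (gen_poly k n * 'X^e)`_n = a k (n%:Z - e%:Z).
Proof.
move=> k0; rewrite coefMXn; case: ltnP => [lt|le].
  by rewrite a_lt0//; lia.
by rewrite coef_gen_poly ?leq_subr// subzn.
Qed.

(** * The recurrence *)

Theorem theorem6p1 (k n : nat) (hk : (2 <= k)%N) (hkn : ~~ (k %| n)%N) :
  a k n%:Z =
    \sum_(j \in [set j : nat | (1 <= j)%N])
      (-1) ^+ (j - 1) *
        (a k (n%:Z - (j * (3 * j - 1) %/ 2)%N%:Z)
         + a k (n%:Z - (j * (3 * j + 1) %/ 2)%N%:Z)).
Proof.
have k0 : (0 < k)%N by apply: leq_trans hk.
have := @euler_gen_supported k n n hkn.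
have [R ->] := euler_prod_shanks n.
rewrite shanks_identity mulrC !mulrDr mulr1 !coefD mulrA coefMXn ltnSn addr0.
rewrite coef_gen_poly// mulr_sumr coef_sum => /eqP; rewrite addr_eq0 => /eqP ->.
(* The terms with j > n vanish, since both pentagonal numbers are at least j. *)
rewrite -sumrN (fsbigE (index_iota 1 n.+1)) ?iota_uniq//; first last.
- move=> j /= j1; rewrite mem_index_iota j1 /= -leqNgt => nj.
  have le1 : (j <= pent j)%N.
    by rewrite leq_divRL// leq_mul2l; apply/orP; right; lia.
  have le2 : (j <= pent_neg j)%N.
    by rewrite leq_divRL// leq_mul2l; apply/orP; right; lia.
  by rewrite -/(pent j) -/(pent_neg j) !a_lt0 ?addr0 ?mulr0//; lia.
- by move=> j /=; rewrite mem_index_iota => /andP[].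
rewrite big_nat_cond [RHS]big_nat_cond.
apply: eq_big => [j|j /andP[/andP[j1 _] _]].
  by rewrite andbT mem_setE /=; case: andP => // -[].
case: j j1 => // j _; rewrite subSS subn0 exprS mulN1r mulNr mulrN coefN opprK.
rewrite mulrCA -signr_odd -[in RHS]signr_odd; case: odd;
  by rewrite ?expr1 ?expr0 ?mulN1r ?mul1r ?coefN mulrDr coefD
     !coef_gen_polyXn.
Qed.
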